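(* Let $\mathcal{D}[t]\subset\mathcal{H}\subset\mathcal{D}^\times[t^\times]$ be a rigged Hilbert space with $\mathcal{D}[t]$ complete and reflexive and $\mathcal{D}^\times[t^\times]$ quasi-complete. Let $\{\xi_n\}$ be a topological basis of $\mathcal{D}[t]$. The following statements are equivalent. (i) $\{\xi_n\}$ is a Riesz-like basis. (ii) There exists a unique sequence $\{\zeta_n\}\subset\mathcal{D}^\times$ such that (a) $\{\xi_n\}$ and $\{\zeta_n\}$ are biorthogonal, i.e. $\langle\zeta_n,\xi_k\rangle=\delta_{n,k}$; (b) $\sum_{n=1}^\infty|\langle\zeta_n,f\rangle|^2<\infty$ for every $f\in\mathcal{D}$; (c) the seminorm $p_\zeta(f)=\big(\sum_{n=1}^\infty|\langle\zeta_n,f\rangle|^2\big)^{1/2}$ is continuous on $\mathcal{D}[t]$. (iii) There exists $S\in\mathcal{L}(\mathcal{D},\mathcal{D}^\times)$ with $S\geq 0$ (i.e. $\langle Sf,f\rangle\geq0$ for all $f\in\mathcal{D}$) such that $\{\xi_n\}$ and $\{S\xi_n\}$ are biorthogonal, i.e. $\langle S\xi_n,\xi_k\rangle=\delta_{n,k}$ for all $n,k$.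
   Context: A rigged Hilbert space $\mathcal{D}[t]\subset\mathcal{H}\subset\mathcal{D}^\times[t^\times]$: $\mathcal{D}$ is a dense subspace of the Hilbert space $\mathcal{H}$ with a locally convex topology $t$ finer than the norm topology, $\mathcal{D}^\times$ is the space of continuous conjugate-linear functionals on $\mathcal{D}[t]$ with the strong dual topology $t^\times=\beta(\mathcal{D}^\times,\mathcal{D})$, $\mathcal{H}\subset\mathcal{D}^\times$, and the duality form $\langle\Phi,f\rangle$ (value of $\Phi\in\mathcal{D}^\times$ at $f\in\mathcal{D}$) extends the inner product. A locally convex space is quasi-complete if every closed bounded subset is complete. A topological basis of $\mathcal{D}[t]$ is a sequence $\{\xi_n\}$ such that every $f\in\mathcal{D}$ has a unique expansion $f=\sum c_n\xi_n$ converging in $\mathcal{D}[t]$; a Schauder basis is a topological basis whose coefficient functionals are $t$-continuous. $\mathcal{L}(\mathcal{D},\mathcal{D}^\times)$ denotes the continuous linear maps $\mathcal{D}[t]\to\mathcal{D}^\times[t^\times]$, and $\mathcal{C}(\mathcal{D},\mathcal{H})$ the set of those mapping $\mathcal{D}$ into $\mathcal{H}$ continuously from $\mathcal{D}[t]$ into $\mathcal{H}$. A Schauder basis $\{\xi_n\}$ of $\mathcal{D}[t]$ is a Riesz-like basis if there exists a one-to-one $T\in\mathcal{C}(\mathcal{D},\mathcal{H})$ such that $\{T\xi_n\}$ is an orthonormal basis of $\mathcal{H}$. *)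

(* Defs.v *)
From HB Require Import structures.
From mathcomp Require Import all_boot all_order all_algebra.
From mathcomp Require Import all_classical all_reals all_analysis.
From mathcomp Require Import complex.
Import Order.TTheory GRing.Theory Num.Theory.
Import numFieldNormedType.Exports.
Local Open Scope ring_scope.
Local Open Scope classical_set_scope.


Section Defs.
Variable R : realType.
Local Notation K := (R[i]).

(** ** Bounded sets in a topological vector space (absorbed by every
    neighbourhood of [0]).  Stated for a topological space [E] with an
    explicit origin [z] and scalar action [scale] so that it can also be
    used for spaces of functionals (where scaling is pointwise). *)
Definition absorbed_by_nbhs (E : topologicalType) (z : E)
    (scale : K -> E -> E) (B : set E) : Prop :=
  forall U : set E, nbhs z U ->
    exists2 r : K, 0 < r &
      forall l : K, r <= `|l| -> B `<=` [set scale l u | u in U].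

Definition tvs_bounded (D : tvsType K) (B : set D) : Prop :=
  absorbed_by_nbhs D (0 : D) (fun l u => l *: u) B.

Definition hilbert_inner_product (H : completeNormedModType K)
    (ip : H -> H -> K) : Prop :=
  [/\ forall (a : K) (x y z : H), ip (a *: x + y) z = a * ip x z + ip y z,
      forall x y : H, ip y x = (ip x y)^* &
      forall x : H, `|x| ^+ 2 = ip x x].

Definition orthonormal_basis (H : completeNormedModType K)
    (ip : H -> H -> K) (e : nat -> H) : Prop :=
  (forall n k : nat, ip (e n) (e k) = (n == k)%:R) /\
  (forall x : H, (forall n, ip x (e n) = 0) -> x = 0).

(** ** Conjugate dual D^x of a tvs [D]: continuous conjugate-linear
    functionals [D -> K]; the duality <Phi, f> is [Phi f]. *)
Definition conj_linear (D : lmodType K) (Phi : D -> K) : Prop :=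
  forall (a : K) (u v : D), Phi (a *: u + v) = a^* * Phi u + Phi v.

Definition dualset (D : tvsType K) : set (D -> K) :=
  [set Phi | conj_linear D Phi /\ continuous (Phi : D -> K^o)].

(** D^x with the strong dual topology beta(D^x, D): the topology of
    uniform convergence on the bounded subsets of D (the carrier is the
    whole function type; D^x is the subset [dualset D]). *)
Definition sdual (D : tvsType K) := {family tvs_bounded D, D -> K^o}.

Definition dzero (D : tvsType K) : sdual D := fun _ => 0.
Definition dscale (D : tvsType K) (l : K) (Phi : sdual D) : sdual D :=
  fun f => l * Phi f.

Definition sdual_bounded (D : tvsType K) (A : set (sdual D)) : Prop :=
  A `<=` dualset D /\ absorbed_by_nbhs (sdual D) (dzero D) (dscale D) A.

Definition complete_set (T : uniformType) (A : set T) : Prop :=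
  forall F : set_system T, ProperFilter F -> cauchy F -> F A ->
    exists2 x, A x & F --> x.

Definition tvs_complete (D : tvsType K) : Prop :=
  forall F : set_system D, ProperFilter F -> cauchy F -> exists x : D, F --> x.

Definition sdual_quasi_complete (D : tvsType K) : Prop :=
  forall A : set (sdual D), A `<=` dualset D ->
    closure A `&` dualset D `<=` A ->
    sdual_bounded D A -> complete_set (sdual D) A.

Definition bidual (D : tvsType K) := {family sdual_bounded D, sdual D -> K^o}.

Definition bidualset (D : tvsType K) : set (bidual D) :=
  [set psi | (forall (a : K) (Phi Psi : sdual D), dualset D Phi ->
                dualset D Psi ->
                psi (fun f => a * Phi f + Psi f) = a^* * psi Phi + psi Psi)
             /\ {within (dualset D : set (sdual D)), continuous (psi : sdual D -> K^o)}].

Definition canon_bidual (D : tvsType K) (f : D) : bidual D :=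
  fun Phi => (Phi f)^*.

Definition tvs_reflexive (D : tvsType K) : Prop :=
  [/\ forall f : D, bidualset D (canon_bidual D f),
      forall psi, bidualset D psi -> exists f : D,
        forall Phi, dualset D Phi -> psi Phi = canon_bidual D f Phi,
      forall f g : D, (forall Phi, dualset D Phi ->
        canon_bidual D f Phi = canon_bidual D g Phi) -> f = g,
      continuous (canon_bidual D) &
      forall (f : D) (U : set D), nbhs f U ->
        exists W : set (bidual D), nbhs (canon_bidual D f) W /\
          forall g : D, W (canon_bidual D g) -> U g].

(** ** Rigged Hilbert space D[t] c H c D^x[t^x].  D is given as a
    locally convex space together with an injective linear map [j]
    into [H] which is continuous (t finer than the norm topology) with
    dense range. *)
Definition rigged_hilbert (H : completeNormedModType K) (ip : H -> H -> K)
    (D : tvsType K) (j : D -> H) : Prop :=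
  [/\ hilbert_inner_product H ip,
      forall (a : K) (u v : D), j (a *: u + v) = a *: j u + j v,
      injective j,
      continuous j &
      closure (range j) = setT].

Definition hemb (H : completeNormedModType K) (ip : H -> H -> K)
    (D : tvsType K) (j : D -> H) (h : H) : sdual D :=
  fun f => ip h (j f).

Definition inL (D : tvsType K) (S : D -> sdual D) : Prop :=
  [/\ forall (a : K) (u v : D) (f : D), S (a *: u + v) f = a * S u f + S v f,
      forall u : D, dualset D (S u) &
      continuous S].

(** C(D, H): operators of L(D, D^x) mapping D into H, continuously from
    D[t] into H.  Such an operator is represented by its H-valued
    version [T]. *)
Definition inC (H : completeNormedModType K) (ip : H -> H -> K)
    (D : tvsType K) (j : D -> H) (T : D -> H) : Prop :=
  inL D (fun u => hemb H ip D j (T u)) /\ continuous T.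

Definition expansion (D : tvsType K) (xi : nat -> D) (c : nat -> K) (f : D)
  : Prop := (fun N => \sum_(0 <= n < N) c n *: xi n) @ \oo --> f.

Definition topological_basis (D : tvsType K) (xi : nat -> D) : Prop :=
  forall f : D, exists c : nat -> K,
    expansion D xi c f /\ forall c', expansion D xi c' f -> c' = c.

Definition schauder_basis (D : tvsType K) (xi : nat -> D) : Prop :=
  topological_basis D xi /\
  exists coef : nat -> D -> K,
    (forall f, expansion D xi (fun n => coef n f) f) /\
    (forall n, continuous (coef n : D -> K^o)).

Definition riesz_like_basis (H : completeNormedModType K) (ip : H -> H -> K)
    (D : tvsType K) (j : D -> H) (xi : nat -> D) : Prop :=
  schauder_basis D xi /\
  exists T : D -> H, [/\ inC H ip D j T, injective T &
                        orthonormal_basis H ip (fun n => T (xi n))].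

Definition biorthogonal (D : tvsType K) (xi : nat -> D) (zeta : nat -> sdual D)
  : Prop := forall n k : nat, zeta n (xi k) = (n == k)%:R.

Definition sq_coef (D : tvsType K) (zeta : nat -> sdual D) (f : D) : nat -> R :=
  fun n => ComplexField.Normc.normc (zeta n f) ^+ 2.

Definition p_zeta (D : tvsType K) (zeta : nat -> sdual D) (f : D) : R :=
  Num.sqrt (limn (series (sq_coef D zeta f))).

End Defs.

Arguments absorbed_by_nbhs {R}.
Arguments tvs_bounded {R}.
Arguments hilbert_inner_product {R}.
Arguments orthonormal_basis {R}.
Arguments conj_linear {R}.
Arguments dualset {R}.
Arguments sdual {R}.
Arguments dzero {R}.
Arguments dscale {R}.
Arguments sdual_bounded {R}.
Arguments tvs_complete {R}.
Arguments sdual_quasi_complete {R}.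
Arguments bidual {R}.
Arguments bidualset {R}.
Arguments canon_bidual {R}.
Arguments tvs_reflexive {R}.
Arguments rigged_hilbert {R}.
Arguments hemb {R}.
Arguments inL {R}.
Arguments inC {R}.
Arguments expansion {R}.
Arguments topological_basis {R}.
Arguments schauder_basis {R}.
Arguments riesz_like_basis {R}.
Arguments biorthogonal {R}.
Arguments sq_coef {R}.
Arguments p_zeta {R}.

(* Main.v *)
(* If T xi_n is orthonormal, then zeta_n = <T xi_n, T .> and S = T^* T have the
   required properties; p_zeta(f) = |T f| by Parseval, and zeta_n is unique
   because its values at f are the conjugates of the expansion coefficients of
   f.  Conversely, Gram-Schmidt applied to the xi_n in H yields an orthonormal
   basis e_n of H, and T f = sum_n <zeta_n, f>^* e_n satisfies
   |T f| = p_zeta(f).  In (iii), zeta_n = S xi_n and Bessel's inequality gives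
   p_zeta(f)^2 <= <S f, f>.  This form is continuous at 0: the set
   {S g : <S g, g> <= 1} is strongly bounded in the dual by Cauchy-Schwarz,
   hence equicontinuous by reflexivity. *)

Require Import Defs.
From HB Require Import structures.
From mathcomp Require Import all_boot all_order all_algebra.
From mathcomp Require Import all_classical all_reals all_analysis.
From mathcomp Require Import complex.
From mathcomp Require Import ring.
Import Order.TTheory GRing.Theory Num.Theory.
Import numFieldNormedType.Exports.
Local Open Scope ring_scope.
Local Open Scope classical_set_scope.

(** * Positive semidefinite sesquilinear forms *)

(** Covers alike the inner product of [H], its pullback to [D] and the form [S f g] of a positive
    operator. *)
Definition psd_form (C : numClosedFieldType) (V : lmodType C)
    (th : V -> V -> C) : Prop :=
  [/\ forall a x y z, th (a *: x + y) z = a * th x z + th y z,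
      forall a x y z, th z (a *: x + y) = a^* * th z x + th z y &
      forall x, 0 <= th x x].

Section PsdForm.
Context {C : numClosedFieldType} {V : lmodType C} {th : V -> V -> C}.
Hypothesis thP : psd_form C V th.

Lemma psd_formDl x y z : th (x + y) z = th x z + th y z.
Proof. by case: thP => lin _ _; rewrite -[x]scale1r lin mul1r scale1r. Qed.

Lemma psd_formDr x y z : th z (x + y) = th z x + th z y.
Proof.
by case: thP => _ lin _; rewrite -[x]scale1r lin conjC1 mul1r scale1r.
Qed.

Lemma psd_form0l z : th 0 z = 0.
Proof. by apply: (addrI (th 0 z)); rewrite -psd_formDl !addr0. Qed.

Lemma psd_form0r z : th z 0 = 0.
Proof. by apply: (addrI (th z 0)); rewrite -psd_formDr !addr0. Qed.

Lemma psd_formZl a x z : th (a *: x) z = a * th x z.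
Proof.
by case: thP => lin _ _; rewrite -[a *: x]addr0 lin psd_form0l addr0.
Qed.

Lemma psd_formZr a x z : th z (a *: x) = a^* * th z x.
Proof.
by case: thP => _ lin _; rewrite -[a *: x]addr0 lin psd_form0r addr0.
Qed.

Lemma psd_formNl x z : th (- x) z = - th x z.
Proof. by rewrite -scaleN1r psd_formZl mulN1r. Qed.

Lemma psd_formNr x z : th z (- x) = - th z x.
Proof. by rewrite -scaleN1r psd_formZr rmorphN /= conjC1 mulN1r. Qed.

Lemma psd_form_suml (r : seq nat) (x : nat -> V) z :
  th (\sum_(n <- r) x n) z = \sum_(n <- r) th (x n) z.
Proof.
by apply: (big_morph (th ^~ z) (fun x y => psd_formDl x y z) (psd_form0l z)).
Qed.

Lemma psd_form_sumr (r : seq nat) (x : nat -> V) z :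
  th z (\sum_(n <- r) x n) = \sum_(n <- r) th z (x n).
Proof.
by apply: (big_morph (th z) (fun x y => psd_formDr x y z) (psd_form0r z)).
Qed.

(* Polarization: [th u u] is real for [u = x + y] and [u = x + i y]. *)
Lemma psd_formC x y : th y x = (th x y)^*.
Proof.
have [_ _ ge0] := thP.
have re u : (th u u)^* = th u u by apply/CrealP/ger0_real.
have e u v : (th u v)^* + (th v u)^* = th u v + th v u.
  have := re (u + v); rewrite !psd_formDl !psd_formDr !rmorphD /= !re => h.
  apply: (addIr (th u u + th v v)).
  transitivity (th u u + (th u v)^* + ((th v u)^* + th v v)); first by ring.
  by rewrite h; ring.
have := e x ('i *: y); rewrite psd_formZl psd_formZr !rmorphM /= conjCK conjCi.
have := e x y.
set a := th x y; set b := th y x; set a' := a^*; set b' := b^* => e1 e2.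
have e3 : a' - b' = b - a.
  apply: (mulfI (neq0Ci C)); transitivity ('i * a' + - 'i * b'); first by ring.
  by rewrite e2; ring.
have two0 : (2 : C) != 0 by rewrite pnatr_eq0.
apply: (mulfI two0); transitivity ((a' + b') + (a' - b')); last by ring.
by rewrite e1 e3; ring.
Qed.

(** Positivity at [x - (s * th x y) *: y] for real [s] gives a nonnegative quadratic polynomial in
    [s], evaluated at a well-chosen [s]. *)
Lemma psd_form_cauchy_schwarz x y : `|th x y| ^+ 2 <= th x x * th y y.
Proof.
have [_ _ ge0] := thP.
set c := `|th x y| ^+ 2.
have c_ge0 : 0 <= c by rewrite exprn_ge0.
have quad s : s \is Num.real ->
    0 <= th x x - s *+ 2 * c + s ^+ 2 * c * th y y.
  move=> sR; have := ge0 (x - (s * th x y) *: y).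
  rewrite psd_formDl psd_formNl psd_formZl !psd_formDr !psd_formNr !psd_formZr.
  rewrite (psd_formC x y) rmorphM /= (CrealP sR) /c normCK.
  set u := th x y; set v := u^*; set a := th x x; set b := th y y.
  by congr (0 <= _); rewrite mulr2n; ring.
have [b0|b0] := eqVneq (th y y) 0; last first.
  (* The quadratic is smallest at [s = (th y y)^-1]. *)
  have bp : 0 < th y y by rewrite lt0r b0 ge0.
  have := quad (th y y)^-1; rewrite realV ger0_real ?ge0 // => /(_ isT).
  have -> : th x x - (th y y)^-1 *+ 2 * c + (th y y)^-1 ^+ 2 * c * th y y =
            th x x - c / th y y by rewrite mulr2n; field.
  by rewrite subr_ge0 ler_pdivrMr.
(* Now the polynomial is affine in [s]; if [c > 0], then [s = (th x x + 1) / c] would give it the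
   negative value [- (th x x + 2)]. *)
rewrite b0 mulr0; have [->//|c0] := eqVneq c 0.
have cp : 0 < c by rewrite lt0r c0.
have sR : (th x x + 1) / c \is Num.real.
  by rewrite ger0_real // divr_ge0 // addr_ge0 // ge0.
have := quad _ sR; rewrite b0 mulr0 addr0.
have -> : th x x - ((th x x + 1) / c) *+ 2 * c = - (th x x + 2).
  by rewrite mulr2n; field.
rewrite oppr_ge0 => /(lt_le_trans _) lt0.
by have := lt0 _ (ltr_wpDl (ge0 x) (ltr0Sn C 1)); rewrite ltxx.
Qed.

(** * Orthonormal sequences and Bessel's inequality *)

Section Orthonormal.
Variable e : nat -> V.
Hypothesis eO : forall n k, th (e n) (e k) = (n == k)%:R.

Lemma orthonormal_coef (r : seq nat) (a : nat -> C) k : uniq r ->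
  th (\sum_(n <- r) a n *: e n) (e k) = if k \in r then a k else 0.
Proof.
move=> ur; rewrite psd_form_suml.
rewrite (eq_bigr (fun n => if n == k then a n else 0)); last first.
  by move=> n _; rewrite psd_formZl eO; case: eqP; rewrite ?mulr1 ?mulr0.
case: ifPn => kr.
  by rewrite (bigD1_seq k) //= eqxx big1 ?addr0 // => n /negbTE ->.
by rewrite big_seq big1 // => n nr; case: eqP kr => // <-; rewrite nr.
Qed.

Lemma orthonormal_pythagoras (r : seq nat) (a : nat -> C) : uniq r ->
  th (\sum_(n <- r) a n *: e n) (\sum_(n <- r) a n *: e n) =
  \sum_(n <- r) `|a n| ^+ 2.
Proof.
move=> ur; rewrite psd_form_sumr big_seq [RHS]big_seq; apply: eq_bigr => k kr.
by rewrite psd_formZr orthonormal_coef // kr normCK mulrC.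
Qed.

(** Each of [th x s], [th s x] and [th s s] equals the sum of the squared coefficients. *)
Lemma orthonormal_residual (r : seq nat) x : uniq r ->
  let s := \sum_(n <- r) th x (e n) *: e n in
  th (x - s) (x - s) = th x x - \sum_(n <- r) `|th x (e n)| ^+ 2.
Proof.
move=> ur s; rewrite psd_formDl psd_formNl !psd_formDr !psd_formNr.
rewrite [th s s]orthonormal_pythagoras //.
have xs : th x s = \sum_(n <- r) `|th x (e n)| ^+ 2.
  rewrite psd_form_sumr; apply: eq_bigr => n _.
  by rewrite psd_formZr normCK mulrC.
have sx : th s x = \sum_(n <- r) `|th x (e n)| ^+ 2.
  rewrite psd_formC xs rmorph_sum; apply: eq_bigr => n _ /=.
  by apply/CrealP; rewrite rpredX // normr_real.
by rewrite xs sx; ring.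
Qed.

Lemma bessel (r : seq nat) x : uniq r ->
  \sum_(n <- r) `|th x (e n)| ^+ 2 <= th x x.
Proof.
case: thP => _ _ ge0 ur.
by rewrite -subr_ge0 -(orthonormal_residual r x ur) ge0.
Qed.

End Orthonormal.
End PsdForm.

(** * Gram-Schmidt orthonormalization *)

Section GramSchmidt.
Context {C : numClosedFieldType} {V : lmodType C} {th : V -> V -> C}.
Hypothesis thP : psd_form C V th.
Hypothesis th_definite : forall x, th x x = 0 -> x = 0.
(* The dual functionals [phi] witness the linear independence of [v]. *)
Variables (v : nat -> V) (phi : nat -> V -> C).
Hypothesis phi_lin :
  forall n a x y, phi n (a *: x + y) = a * phi n x + phi n y.
Hypothesis phi_v : forall n k, phi n (v k) = (n == k)%:R.

(** The recursion carries the whole list, since each step projects on all earlier vectors. *)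
Fixpoint gram_schmidt_seq (n : nat) : seq V :=
  if n is n'.+1 then
    let s := gram_schmidt_seq n' in
    let w := v n' - \sum_(u <- s) th (v n') u *: u in
    rcons s ((sqrtC (th w w))^-1 *: w)
  else [::].

Definition gram_schmidt (n : nat) : V := nth 0 (gram_schmidt_seq n.+1) n.

Definition gram_schmidt_residual (n : nat) : V :=
  v n - \sum_(0 <= k < n) th (v n) (gram_schmidt k) *: gram_schmidt k.

Lemma size_gram_schmidt_seq n : size (gram_schmidt_seq n) = n.
Proof. by elim: n => //= n IH; rewrite size_rcons IH. Qed.

Lemma nth_gram_schmidt_seq n k : (k < n)%N ->
  nth 0 (gram_schmidt_seq n) k = gram_schmidt k.
Proof.
elim: n => // n IH; rewrite ltnS leq_eqVlt => /predU1P[->//|kn].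
by rewrite /= nth_rcons size_gram_schmidt_seq kn IH.
Qed.

Lemma gram_schmidtE n : let w := gram_schmidt_residual n in
  gram_schmidt n = (sqrtC (th w w))^-1 *: w.
Proof.
rewrite /gram_schmidt /= nth_rcons size_gram_schmidt_seq ltnn eqxx.
suff -> : \sum_(u <- gram_schmidt_seq n) th (v n) u *: u =
  \sum_(0 <= k < n) th (v n) (gram_schmidt k) *: gram_schmidt k by [].
rewrite (big_nth 0) size_gram_schmidt_seq; apply: eq_big_nat => k /andP[_ kn].
by rewrite nth_gram_schmidt_seq.
Qed.

(** [gram_schmidt n] lies in the span of [v 0], ..., [v n], where every later [phi m] vanishes; and
    [phi n] is 1 on the residual, which is therefore nonzero. *)
Lemma gram_schmidt_triangular n :
  (forall m, (n < m)%N -> phi m (gram_schmidt n) = 0) /\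
  gram_schmidt_residual n != 0.
Proof.
have phi0 m : phi m 0 = 0.
  by have := phi_lin m (-1) 0 0; rewrite scaler0 addr0 mulN1r addNr.
have phiZ m a x : phi m (a *: x) = a * phi m x.
  by rewrite -[a *: x]addr0 phi_lin phi0 addr0.
have phiD m x y : phi m (x + y) = phi m x + phi m y.
  by rewrite -[x]scale1r phi_lin mul1r scale1r.
elim/ltn_ind: n => n IH.
(* By induction [phi m] kills the subtracted vectors, so only [phi m (v n)] is left. *)
have phi_res m : (n <= m)%N -> phi m (gram_schmidt_residual n) = (m == n)%:R.
  move=> nm; rewrite /gram_schmidt_residual phiD -scaleN1r phiZ phi_v.
  rewrite (big_morph (phi m) (phiD m) (phi0 m)) big_nat big1 ?mulr0 ?addr0 //.
  move=> k /andP[_ kn]; rewrite phiZ.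
  by rewrite (IH k kn).1 ?mulr0 // (leq_trans kn).
split=> [m nm|].
  by rewrite gram_schmidtE phiZ phi_res ?(ltnW nm) // gtn_eqF // mulr0.
apply/eqP => res0; have := phi_res n (leqnn n); rewrite res0 phi0 eqxx.
by move/eqP; rewrite eq_sym oner_eq0.
Qed.

Lemma gram_schmidt_sqrt_neq0 n :
  sqrtC (th (gram_schmidt_residual n) (gram_schmidt_residual n)) != 0.
Proof.
rewrite sqrtC_eq0; apply: contra (gram_schmidt_triangular n).2.
by move=> /eqP/th_definite->.
Qed.

Lemma gram_schmidt_orthonormal n k :
  th (gram_schmidt n) (gram_schmidt k) = (n == k)%:R.
Proof.
(* Hermitian symmetry reduces the claim to [k <= n]. *)
suff {n k} lower n : forall k, (k <= n)%N ->
    th (gram_schmidt n) (gram_schmidt k) = (n == k)%:R.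
  have [kn|/ltnW nk] := leqP k n; first exact: lower.
  by rewrite (psd_formC thP) lower // conjC_nat eq_sym.
elim/ltn_ind: n => n IH k; rewrite leq_eqVlt => /predU1P[->|kn].
  rewrite eqxx mulr1n gram_schmidtE (psd_formZl thP) (psd_formZr thP).
  have [_ _ ge0] := thP; have := gram_schmidt_sqrt_neq0 n.
  set w := gram_schmidt_residual n; set c := sqrtC _ => c0.
  have cR : c^-1 ^* = c^-1.
    by apply/CrealP; rewrite realV ger0_real // sqrtC_ge0.
  by rewrite cR -[th w w]sqrtCK -/c; field.
suff res0 : th (gram_schmidt_residual n) (gram_schmidt k) = 0.
  by rewrite gram_schmidtE (psd_formZl thP) res0 mulr0 gtn_eqF.
(* By induction only the [k]-th term of the sum contributes, and it cancels
   [th (v n) (gram_schmidt k)]. *)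
rewrite /gram_schmidt_residual (psd_formDl thP) (psd_formNl thP).
rewrite (psd_form_suml thP) (bigD1_seq k) ?iota_uniq ?mem_index_iota //=.
rewrite (psd_formZl thP) IH // eqxx mulr1 big_nat_cond big1 ?addr0 ?subrr //.
move=> l /andP[/andP[_ ln] lk]; rewrite (psd_formZl thP).
have [kl|/ltnW lek] := leqP k l; first by rewrite IH // (negbTE lk) mulr0.
rewrite (psd_formC thP (gram_schmidt k)) IH // eq_sym (negbTE lk).
by rewrite conjC0 mulr0.
Qed.

(** Solve the formula for [gram_schmidt n] for [v n]; the diagonal coefficient is the norm of the
    residual. *)
Lemma gram_schmidt_span n :
  exists a : nat -> C, v n = \sum_(0 <= k < n.+1) a k *: gram_schmidt k.
Proof.
pose w := gram_schmidt_residual n.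
exists (fun k => if (k < n)%N then th (v n) (gram_schmidt k)
                 else sqrtC (th w w)).
rewrite big_nat_recr //= ltnn [X in _ *: X]gram_schmidtE -/w scalerA.
rewrite divff ?gram_schmidt_sqrt_neq0 // scale1r.
rewrite -[LHS](subrK (\sum_(0 <= k < n)
  th (v n) (gram_schmidt k) *: gram_schmidt k)) addrC; congr (_ + _).
by apply: eq_big_nat => k /andP[_ ->].
Qed.

End GramSchmidt.

(** * Uniform convergence on a family of sets *)

Section UniformConvergence.
Context {C : numFieldType} {U : choiceType}.

Lemma uniform_cvgrP (A : set U) (F : set_system (U -> C^o)) (f : U -> C^o) :
  Filter F -> {uniform A, F --> f} <->
  (forall e : C, 0 < e ->
     \forall g \near F, forall x, A x -> `|f x - g x| < e).
Proof.
move=> FF; split=> [Ff e e0|Ff P /uniform_nbhs[E [entE EP]]].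
  apply: Ff; apply/uniform_nbhs; exists [set xy | `|xy.1 - xy.2| < e].
  split; last by move=> g /=.
  by rewrite -entourage_ballE; exists e.
move: entE; rewrite -entourage_ballE => -[e /= e0 eE].
apply: filterS (Ff e e0) => g fg; apply: EP => x Ax; apply: eE; exact: fg.
Qed.

(** Serves both strong topologies: that of [sdual], with the bounded sets of [D], and that of
    [bidual], with the bounded sets of the dual. *)
Lemma family_cvgrP (fam : set U -> Prop) (F : set_system (U -> C^o))
    (f : {family fam, U -> C^o}) : Filter F -> F --> f <->
  (forall A, fam A -> forall e : C, 0 < e ->
     \forall g \near F, forall x, A x -> `|f x - g x| < e).
Proof.
move=> FF; split=> [/fam_cvgP Ff A fA|Ff].
  by apply/uniform_cvgrP; exact: Ff.
by apply/fam_cvgP => A fA; apply/uniform_cvgrP; exact: Ff.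
Qed.

End UniformConvergence.

(** * Continuity at the origin and bounded sets *)

Section AdditiveContinuity.
Context {R : realType} {D : tvsType R[i]}.
Local Notation K := R[i].

Lemma near_sub (u : D) (P : set D) :
  (\forall v \near (0 : D), P v) -> \forall v \near u, P (v - u).
Proof.
move=> P0; apply: filterS (nbhsT u P0) => v [w Pw <-].
by rewrite addrAC subrr add0r.
Qed.

Lemma additive_continuous {H : normedModType K} (T : D -> H) :
  (forall u v, T (u - v) = T u - T v) ->
  (forall e : K, 0 < e -> \forall u \near (0 : D), `|T u| < e) -> continuous T.
Proof.
move=> TB T0 u; apply/cvgrPdist_lt => e e0.
by apply: filterS (near_sub u _ (T0 e e0)) => v; rewrite TB distrC.
Qed.

Lemma continuous0_near {H : normedModType K} (T : D -> H) : T 0 = 0 ->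
  continuous T -> forall e : K, 0 < e -> \forall u \near (0 : D), `|T u| < e.
Proof.
move=> T0 Tc e e0; have /cvgrPdist_lt/(_ e e0) := Tc 0.
by apply: filterS => u; rewrite T0 sub0r normrN.
Qed.

Lemma additive_sdual_continuous (S : D -> sdual D) :
  (forall u v f, S (u - v) f = S u f - S v f) ->
  (forall B, tvs_bounded D B -> forall e : K, 0 < e ->
    \forall u \near (0 : D), forall f, B f -> `|S u f| < e) ->
  continuous S.
Proof.
move=> SB S0 u; apply/family_cvgrP => B bB e e0.
apply: filterS (near_sub u _ (S0 B bB e e0)) => v h f Bf.
by rewrite distrC -SB; exact: h.
Qed.

Lemma sdual_continuous0_near (S : D -> sdual D) : (forall f, S 0 f = 0) ->
  continuous S ->
  forall B, tvs_bounded D B -> forall e : K, 0 < e ->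
    \forall u \near (0 : D), forall f, B f -> `|S u f| < e.
Proof.
move=> S0 Sc B bB e e0.
have /family_cvgrP/(_ B bB e e0) S0e := Sc 0.
have : \forall u \near (0 : D), forall f, B f -> `|S 0 f - S u f| < e by [].
apply: filterS => u h f Bf.
by have := h f Bf; rewrite S0 sub0r normrN.
Qed.

(** The neighbourhood where [p u < 1] absorbs [B], and homogeneity turns the absorbing factor into a
    bound. *)
Lemma tvs_bounded_homogeneous (B : set D) (p : D -> K) :
  tvs_bounded D B -> (forall l u, p (l *: u) = `|l| * p u) ->
  (\forall u \near (0 : D), p u < 1) ->
  exists2 M : K, 0 < M & forall f, B f -> p f <= M.
Proof.
move=> bB pZ /bB[r r0 rB]; exists r => // f Bf.
have rr : r <= `|r| by rewrite gtr0_norm.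
have [u /= pu <-] := rB r rr f Bf; rewrite pZ gtr0_norm // -[leRHS]mulr1.
by rewrite ler_pM2l // ltW.
Qed.

Lemma sdual_boundedP (A : set (sdual D)) : A `<=` dualset D ->
  (forall B, tvs_bounded D B ->
     exists2 M : K, 0 < M & forall Phi f, A Phi -> B f -> `|Phi f| <= M) ->
  sdual_bounded D A.
Proof.
move=> AD bA; split=> //.
(* The sets absorbing [A] form a filter, so that uniform smallness can be
   tested on one bounded set at a time. *)
pose absorbing : set_system (sdual D) := [set U | exists2 r : K, 0 < r &
  forall l : K, r <= `|l| -> A `<=` [set Defs.dscale D l u | u in U]].
have absF : Filter absorbing.
  have lneq0 (r l : K) : 0 < r -> r <= `|l| -> l != 0.
    by move=> r0 rl; rewrite -normr_gt0 (lt_le_trans r0).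
  split.
  - exists 1 => // l l1 Phi _; exists (fun f => l^-1 * Phi f) => //.
    apply/funext => f; rewrite /Defs.dscale mulrA divff ?mul1r //.
    exact: lneq0 ltr01 l1.
  - move=> P Q [r r0 rP] [s s0 sQ]; exists (r + s); first exact: addr_gt0.
    move=> l rsl Phi APhi.
    have rl : r <= `|l| by rewrite (le_trans _ rsl) // lerDl ltW.
    have sl : s <= `|l| by rewrite (le_trans _ rsl) // lerDr ltW.
    have [Psi PPsi ePsi] := rP l rl Phi APhi.
    have [Psi' QPsi' ePsi'] := sQ l sl Phi APhi.
    exists Psi => //; split=> //.
    (* Scaling by a nonzero [l] is injective, so both preimages of [Phi] coincide. *)
    suff -> : Psi = Psi' by [].
    apply/funext => f; apply: (mulfI (lneq0 _ _ r0 rl)).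
    have : Defs.dscale D l Psi f = Defs.dscale D l Psi' f by rewrite ePsi ePsi'.
    by [].
  - move=> P Q PQ [r r0 rP]; exists r => // l rl Phi /(rP l rl)[Psi PPsi <-].
    by exists Psi => //; exact: PQ.
suff : absorbing --> dzero D by apply.
apply/family_cvgrP => B bB e e0; have [M M0 AM] := bA B bB.
have r0 : 0 < M / e + 1 by rewrite addr_gt0 // divr_gt0.
(* Dividing by such an [l] brings the bound [M] below [e]; the added 1 makes the inequality
   strict. *)
exists (M / e + 1) => // l rl Phi APhi.
have l0 : 0 < `|l| by rewrite (lt_le_trans r0).
exists (fun f => l^-1 * Phi f); last first.
  by apply/funext => f; rewrite /Defs.dscale mulrA divff ?mul1r // -normr_gt0.
move=> f Bf; rewrite /dzero sub0r normrN normrM normfV.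
rewrite ltr_pdivrMl // (le_lt_trans (AM _ _ APhi Bf)) //.
by rewrite -ltr_pdivrMr // (lt_le_trans _ rl) // ltrDl.
Qed.

End AdditiveContinuity.

(** * Orthonormal bases of a Hilbert space *)

Section Hilbert.
Context {R : realType} {H : completeNormedModType R[i]}.
Context {ip : H -> H -> R[i]}.
Local Notation K := R[i].
Local Notation normc := ComplexField.Normc.normc.
Hypothesis hip : hilbert_inner_product H ip.

(** The norm of [R[i]] takes values in [R[i]], whereas the series of squares live in [R]; this
    passes between the two. *)
Lemma normr_normc (a : K) : `|a| = (normc a)%:C%C.
Proof. by rewrite normc_def; case: a. Qed.

Lemma sqr_normr_normc (a : K) : `|a| ^+ 2 = (normc a ^+ 2)%:C%C.
Proof. by rewrite normr_normc -rmorphXn. Qed.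

Lemma cvg_Re {T : Type} {F : set_system T} {FF : Filter F} (f : T -> K^o)
    (x : K^o) :
  f @ F --> x -> (fun t => complex.Re (f t)) @ F --> complex.Re x.
Proof.
move=> fx; apply/cvgrPdist_lt => e e0.
have eC : 0 < e%:C%C :> K by rewrite ltcR.
have /cvgrPdist_lt/(_ _ eC) := fx; apply: filterS => t xt.
rewrite -ltcR (le_lt_trans _ xt) // -raddfB.
exact: normc_ge_Re.
Qed.

Lemma ip_psd : psd_form K H ip.
Proof.
case: hip => lin herm sq; split=> [//|a x y z|x].
  by rewrite herm lin rmorphD rmorphM /= -!herm.
by rewrite -sq exprn_ge0.
Qed.

Lemma ip_norm_le x y : `|ip x y| <= `|x| * `|y|.
Proof.
case: (hip) => _ _ sq.
rewrite -(@ler_pXn2r _ 2) ?nnegrE ?mulr_ge0 // exprMn !sq.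
exact: psd_form_cauchy_schwarz ip_psd x y.
Qed.

Lemma cvg_ipl {T : Type} {F : set_system T} {FF : Filter F} (f : T -> H) x y :
  f @ F --> x -> (fun t => ip (f t) y : K^o) @ F --> (ip x y : K^o).
Proof.
move=> fx; apply/cvgrPdist_lt => e e0.
have y0 : 0 < `|y| + 1 by rewrite ltr_wpDl.
have /cvgrPdist_lt/(_ (e / (`|y| + 1)) (divr_gt0 e0 y0)) := fx.
apply: filterS => t; rewrite ltr_pdivlMr // => xt.
rewrite -(psd_formNl ip_psd) -(psd_formDl ip_psd).
apply: (le_lt_trans (ip_norm_le _ _)); apply: le_lt_trans xt.
by rewrite ler_wpM2l // lerDl.
Qed.

Lemma cvg_ipr {T : Type} {F : set_system T} {FF : Filter F} (f : T -> H) x y :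
  f @ F --> x -> (fun t => ip y (f t) : K^o) @ F --> (ip y x : K^o).
Proof.
move=> /(cvg_ipl _ _ y)/cvgrPdist_lt fx; apply/cvgrPdist_lt => e e0.
apply: filterS (fx e e0) => t.
by rewrite (psd_formC ip_psd x) (psd_formC ip_psd (f t)) -rmorphB norm_conjC.
Qed.

Lemma sqr_norm_ip x : `|x| ^+ 2 = ip x x.
Proof. by case: hip. Qed.

(** By Pythagoras a block of the vector series has the block of squares as squared norm, so the
    series is Cauchy in the complete space [H]; continuity of [ip] gives the coefficients of its
    sum. *)
Lemma riesz_fischer (e : nat -> H) (a : nat -> K) :
  (forall n k, ip (e n) (e k) = (n == k)%:R) ->
  cvgn (series (fun n => normc (a n) ^+ 2)) ->
  exists x, series (fun n => a n *: e n) @ \oo --> x /\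
    forall n, ip x (e n) = a n.
Proof.
move=> eO ca.
have : cvgn (series (fun n => a n *: e n)).
  apply/cauchy_cvgP/cauchy_seriesP => d d0.
  have /cauchy_cvgP/cauchy_seriesP := ca.
  have dE : d = (complex.Re d)%:C%C by rewrite RRe_real // gtr0_real.
  have rd0 : 0 < complex.Re d by move: d0; rewrite dE ltcR.
  move=> /(_ (complex.Re d ^+ 2) (exprn_gt0 _ rd0)).
  apply: filterS => -[m n] /= mn.
  rewrite -(@ltr_pXn2r _ 2) ?nnegrE // ?ltW // sqr_norm_ip.
  rewrite (orthonormal_pythagoras ip_psd e eO) ?iota_uniq //.
  rewrite (eq_bigr _ (fun n _ => sqr_normr_normc (a n))) -rmorph_sum /=.
  rewrite [X in _ < X ^+ 2]dE -rmorphXn ltcR.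
  by rewrite ger0_norm // in mn; apply: sumr_ge0 => i _; rewrite sqr_ge0.
move=> /cvg_ex[x sx]; exists x; split=> // n.
have h : (fun N => ip (series (fun n => a n *: e n) N) (e n) : K^o) @ \oo -->
    (ip x (e n) : K^o) by exact: cvg_ipl.
apply: (cvg_unique (@norm_hausdorff _ K^o) h).
(* The [N]-th partial sum stops before index [N], so its [n]-th coefficient is [a n] from [N = n.+1]
   on. *)
apply: cvg_near_cst; exists n.+1 => // N /= nN.
rewrite /series /= (orthonormal_coef ip_psd e eO) ?iota_uniq //.
by rewrite mem_index_iota nN.
Qed.

(** Bessel makes the squares summable, Riesz-Fischer gives a vector with the same coefficients as
    [x], and totality identifies it with [x]. *)
Lemma parseval (e : nat -> H) x : orthonormal_basis H ip e ->
  series (fun n => normc (ip x (e n)) ^+ 2) @ \oo --> complex.Re (ip x x).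
Proof.
move=> [eO eT].
have reE z : ip z z = (complex.Re (ip z z))%:C%C.
  by rewrite RRe_real // ger0_real //; case: ip_psd.
have partE y N : \sum_(0 <= n < N) `|ip y (e n)| ^+ 2 =
    (series (fun n => normc (ip y (e n)) ^+ 2) N)%:C%C.
  rewrite (eq_bigr _ (fun n _ => sqr_normr_normc (ip y (e n)))).
  by rewrite -rmorph_sum.
have cx : cvgn (series (fun n => normc (ip x (e n)) ^+ 2)).
  apply: nondecreasing_is_cvgn.
    by apply: nondecreasing_series => n _ _; rewrite sqr_ge0.
  exists (complex.Re (ip x x)) => _ [N _ <-].
  by rewrite -lecR -reE -partE; apply: (bessel ip_psd); rewrite ?iota_uniq.
have [y [sy yx]] := riesz_fischer _ _ eO cx.
have -> : x = y.
  apply/eqP; rewrite -subr_eq0; apply/eqP/eT => n.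
  by rewrite (psd_formDl ip_psd) (psd_formNl ip_psd) yx subrr.
(* The sums of squares are the inner products with [y] of partial sums converging to [y]. *)
suff -> : series (fun n => normc (ip y (e n)) ^+ 2) =
  (fun N => complex.Re (ip (series (fun n => ip x (e n) *: e n) N) y)).
  by apply: cvg_Re; exact: cvg_ipl.
apply/funext => N; rewrite {2}/series /= (psd_form_suml ip_psd).
rewrite (eq_bigr (fun n => `|ip y (e n)| ^+ 2)) ?partE // => n _.
by rewrite (psd_formZl ip_psd) (psd_formC ip_psd y) yx normCK.
Qed.

End Hilbert.

(** * Operators on the rigged Hilbert space *)

Section RiggedHilbert.
Context {R : realType} {H : completeNormedModType R[i]}.
Context {ip : H -> H -> R[i]} {D : tvsType R[i]} {j : D -> H}.
Local Notation K := R[i].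
Local Notation normc := ComplexField.Normc.normc.
Hypothesis rigged : rigged_hilbert H ip D j.

Let hip : hilbert_inner_product H ip. Proof. by case: rigged. Qed.
Let psd := ip_psd hip.

Lemma ip_definite x : ip x x = 0 -> x = 0.
Proof.
by rewrite -(sqr_norm_ip hip) => /eqP; rewrite sqrf_eq0 normr_eq0 => /eqP.
Qed.

(** For [x] nonzero, density gives [j f] closer to [x] than [|x|]; then
    [|x|^2 = ip x (x - j f) < |x|^2]. *)
Lemma ip_range_eq0 x : (forall f, ip x (j f) = 0) -> x = 0.
Proof.
move=> xj; have [_ _ _ _ dense] := rigged.
have : closure (range j) x by rewrite dense.
apply: contraPP => /eqP x0 /(_ (ball x `|x|)); rewrite -normr_gt0 in x0.
case; first exact: nbhsx_ballx.
move=> _ [[f _ <-]]; rewrite -ball_normE /= => xf.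
have : `|x| ^+ 2 < `|x| ^+ 2.
  rewrite {1}(sqr_norm_ip hip) -[X in X < _]subr0 -(xj f).
  rewrite -(psd_formNr psd) -(psd_formDr psd).
  rewrite -[X in X < _]ger0_norm; last first.
    rewrite (psd_formDr psd) (psd_formNr psd) xj subr0.
    by case: psd => _ _; apply.
  rewrite (le_lt_trans (ip_norm_le hip _ _)) // expr2 ltr_pM2l //.
by rewrite ltxx.
Qed.

Definition linear_op (T : D -> H) : Prop :=
  forall (a : K) (u v : D), T (a *: u + v) = a *: T u + T v.

Lemma linear_opB T u v : linear_op T -> T (u - v) = T u - T v.
Proof. by move=> lT; rewrite -[u - v]addrC -scaleN1r lT scaleN1r addrC. Qed.

Lemma linear_op0 T : linear_op T -> T 0 = 0.
Proof. by move=> lT; rewrite -(subrr 0) linear_opB // subrr. Qed.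

Lemma linear_opZ T a u : linear_op T -> T (a *: u) = a *: T u.
Proof. by move=> lT; rewrite -[a *: u]addr0 lT linear_op0 // addr0. Qed.

(** Used with [T2 = j], for the embedding of [T1], and with [T1 = T2], for the adjoint square. A
    continuous [T2] is bounded on bounded sets, so Cauchy-Schwarz gives uniform smallness. *)
Lemma inL_ip (T1 T2 : D -> H) : linear_op T1 -> continuous T1 ->
  linear_op T2 -> continuous T2 -> inL D (fun u f => ip (T1 u) (T2 f)).
Proof.
have [ipl ipr _] := psd.
move=> l1 c1 l2 c2; split.
- by move=> a u v f; rewrite l1 ipl.
- move=> u; split=> [a v w|f]; first by rewrite l2 ipr.
  by apply: cvg_ipr => //; exact: c2.
apply: additive_sdual_continuous => [u v f|B bB e e0].
  by rewrite (linear_opB _ _ _ l1) (psd_formDl psd) (psd_formNl psd).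
have [M M0 BM] : exists2 M : K, 0 < M & forall f, B f -> `|T2 f| <= M.
  apply: tvs_bounded_homogeneous => // [l u|].
    by rewrite (linear_opZ _ _ _ l2) normrZ.
  exact: continuous0_near (linear_op0 _ l2) c2 _ ltr01.
have := continuous0_near _ (linear_op0 _ l1) c1 _ (divr_gt0 e0 M0).
apply: filterS => u; rewrite ltr_pdivlMr // => uM f Bf.
rewrite (le_lt_trans (ip_norm_le hip _ _)) // (le_lt_trans _ uM) //.
by rewrite ler_wpM2l // BM.
Qed.

(** Linearity is given for the functionals [ip (T u) (j f)] and passes to [T] by density of the
    range of [j]. *)
Lemma inC_linear (T : D -> H) : inC H ip D j T -> linear_op T.
Proof.
case=> -[lin _ _] _ a u v; apply/eqP; rewrite -subr_eq0; apply/eqP.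
apply: ip_range_eq0 => f.
rewrite (psd_formDl psd) (psd_formNl psd) (psd_formDl psd) (psd_formZl psd).
by have := lin a u v f; rewrite /hemb => ->; rewrite subrr.
Qed.

(** * Biorthogonal sequences and expansions *)

Section Basis.
Context {xi : nat -> D}.
Hypothesis xi_basis : topological_basis D xi.

(** Uniqueness of limits is transported from [H] through the continuous injection [j]. *)
Lemma expansion_injective c f g :
  expansion D xi c f -> expansion D xi c g -> f = g.
Proof.
have [_ _ jI jc _] := rigged; move=> ef eg; apply: jI.
have cj h : expansion D xi c h ->
    (j \o fun N => \sum_(0 <= n < N) c n *: xi n) @ \oo --> j h.
  by move=> eh; apply: continuous_cvg => //; exact: jc.
exact: (cvg_unique (@norm_hausdorff _ H) (cj f ef) (cj g eg)).
Qed.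

Section Biorthogonal.
Variable zeta : nat -> sdual D.
Hypothesis zeta_dual : forall n, dualset D (zeta n).
Hypothesis zeta_xi : biorthogonal D xi zeta.

Lemma zeta_lin n (a : K) u v :
  (zeta n (a *: u + v))^* = a * (zeta n u)^* + (zeta n v)^*.
Proof.
by have [-> _] := zeta_dual n; rewrite rmorphD rmorphM /= conjCK.
Qed.

Lemma zeta_xiC n k : (zeta n (xi k))^* = (n == k)%:R.
Proof. by rewrite zeta_xi conjC_nat. Qed.

(** The continuous functional [zeta n], applied to the expansion of [f], picks out the conjugate of
    its [n]-th coefficient. *)
Lemma biorthogonal_expansion f : expansion D xi (fun n => (zeta n f)^*) f.
Proof.
have [c [cf _]] := xi_basis f.
suff -> : (fun n => (zeta n f)^*) = c by [].
apply/funext => n.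
have [_ zc] := zeta_dual n.
have zD u v : (zeta n (u + v))^* = (zeta n u)^* + (zeta n v)^*.
  by have := zeta_lin n 1 u v; rewrite scale1r mul1r.
have z0 : (zeta n 0)^* = 0.
  by apply: (addrI (zeta n 0)^*); rewrite -zD !addr0.
have zZ a u : (zeta n (a *: u))^* = a * (zeta n u)^*.
  by rewrite -[a *: u]addr0 zeta_lin z0 addr0.
rewrite -[RHS]conjCK; congr (_^*).
have h : (fun N => zeta n (\sum_(0 <= k < N) c k *: xi k) : K^o) @ \oo -->
    (zeta n f : K^o).
  by apply: continuous_cvg => //; exact: zc.
apply: (cvg_unique (@norm_hausdorff _ K^o) h).
apply: cvg_near_cst; exists n.+1 => // N /= nN.
apply: (can_inj (@conjCK K)); rewrite conjCK.
rewrite (big_morph (fun u => (zeta n u)^*) zD z0) (bigD1_seq n) ?iota_uniq //=.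
  rewrite zZ zeta_xiC eqxx mulr1 big1 ?addr0 // => k kn.
  by rewrite zZ zeta_xiC eq_sym (negbTE kn) mulr0.
by rewrite mem_index_iota.
Qed.

Lemma biorthogonal_schauder : schauder_basis D xi.
Proof.
split=> //; exists (fun n f => (zeta n f)^*); split.
  exact: biorthogonal_expansion.
move=> n f; have [_ zc] := zeta_dual n; apply/cvgrPdist_lt => e e0.
have /cvgrPdist_lt/(_ e e0) := zc f; apply: filterS => g.
by rewrite -rmorphB norm_conjC.
Qed.

(** Pulling the inner product back lets Gram-Schmidt run in [D], where the functionals [zeta n]
    witness independence. *)
Let ipj (u v : D) : K := ip (j u) (j v).

Let ipj_psd : psd_form K D ipj.
Proof.
have [_ jl _ _ _] := rigged; have [ipl ipr ip0] := psd.
by split=> *; rewrite /ipj ?jl ?ipl ?ipr //; exact: ip0.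
Qed.

Let ipj_definite u : ipj u u = 0 -> u = 0.
Proof.
have [_ jl jI _ _] := rigged.
by move=> /ip_definite ju; apply: jI; rewrite ju linear_op0.
Qed.

(** Totality: a vector orthogonal to the Gram-Schmidt vectors is orthogonal to each [j (xi n)],
    hence by expansion to the dense range of [j]. *)
Lemma exists_orthonormal_basis : exists e : nat -> H, orthonormal_basis H ip e.
Proof.
have [_ jl _ jc _] := rigged.
pose phi n f := (zeta n f)^*.
exists (fun n => j (gram_schmidt (th := ipj) xi n)); split.
  exact: gram_schmidt_orthonormal ipj_psd ipj_definite _ _ zeta_lin zeta_xiC.
move=> x xe; apply: ip_range_eq0 => f.
have jD u v : j (u + v) = j u + j v.
  by have := jl 1 u v; rewrite !scale1r.
have j0 := linear_op0 _ jl.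
have xxi n : ip x (j (xi n)) = 0.
  have [a ->] :=
    gram_schmidt_span (th := ipj) ipj_definite xi phi zeta_lin zeta_xiC n.
  rewrite (big_morph j jD j0) (psd_form_sumr psd) big1 // => k _.
  by rewrite (linear_opZ _ _ _ jl) (psd_formZr psd) xe mulr0.
have h : (fun N => ip x (j (\sum_(0 <= k < N) (zeta k f)^* *: xi k)) : K^o)
    @ \oo --> (ip x (j f) : K^o).
  apply: cvg_ipr => //; apply: continuous_cvg; first exact: jc.
  exact: biorthogonal_expansion.
apply: (cvg_unique (@norm_hausdorff _ K^o) h).
apply: cvg_near_cst; near=> N.
rewrite (big_morph j jD j0) (psd_form_sumr psd) big1 // => k _.
by rewrite (linear_opZ _ _ _ jl) (psd_formZr psd) xxi mulr0.
Unshelve. all: by end_near. Qed.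

(** The majorant [q f] will be the square of [p_zeta] in one application and the real part of
    [S f f] in the other. *)
Lemma biorthogonal_riesz_like (q : D -> R) :
  (forall N f, series (sq_coef D zeta f) N <= q f) ->
  (forall d, 0 < d -> \forall f \near (0 : D), q f < d) ->
  riesz_like_basis H ip D j xi.
Proof.
move=> zq q0; split; first exact: biorthogonal_schauder.
have [e eB] := exists_orthonormal_basis; have [eO eT] := eB.
have [_ jl _ jc _] := rigged.
have sqE f : (fun n => normc ((zeta n f)^*) ^+ 2) = sq_coef D zeta f.
  apply/funext => n; rewrite /sq_coef; congr (_ ^+ 2).
  by case: (zeta n f) => a b; rewrite /= sqrrN.
have zcvg f : cvgn (series (sq_coef D zeta f)).
  apply: nondecreasing_is_cvgn.
    by apply: nondecreasing_series => n _ _; rewrite sqr_ge0.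
  by exists (q f) => _ [N _ <-].
have /choice[T Te] : forall f, exists x, forall n, ip x (e n) = (zeta n f)^*.
  move=> f; have := zcvg f; rewrite -sqE.
  move=> /(riesz_fischer hip e _ eO)[x [_ xe]].
  by exists x.
(* Coordinates determine a vector, so the chosen [T] is linear and maps [xi n] to [e n]. *)
have e_inj x y : (forall n, ip x (e n) = ip y (e n)) -> x = y.
  move=> xy; apply/eqP; rewrite -subr_eq0; apply/eqP/eT => n.
  by rewrite (psd_formDl psd) (psd_formNl psd) xy subrr.
have Tl : linear_op T.
  move=> a u v; apply: e_inj => n; rewrite (psd_formDl psd) (psd_formZl psd).
  by rewrite !Te zeta_lin.
have Txi : (fun n => T (xi n)) = e.
  by apply/funext => n; apply: e_inj => k; rewrite Te eO zeta_xiC eq_sym.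
have Tq f : complex.Re (ip (T f) (T f)) <= q f.
  have Tf := parseval hip e (T f) eB.
  apply: (cvgr_to_le Tf).
  apply: nearW => N; apply: le_trans (zq N f).
  by rewrite -sqE; under eq_fun do rewrite Te.
have Tc : continuous T.
  apply: additive_continuous => [u v|d d0]; first exact: linear_opB.
  have dE : d = (complex.Re d)%:C%C by rewrite RRe_real // gtr0_real.
  have rd0 : 0 < complex.Re d by move: d0; rewrite dE ltcR.
  apply: filterS (q0 _ (exprn_gt0 2 rd0)) => f qf.
  rewrite -(@ltr_pXn2r _ 2) ?nnegrE // ?ltW // (sqr_norm_ip hip).
  have [_ _ ip0] := psd.
  rewrite -[ip _ _]RRe_real ?ger0_real // dE -rmorphXn ltcR.
  exact: le_lt_trans (Tq f) qf.
exists T; split.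
- by split=> //; exact: inL_ip.
(* Equal images have equal coordinates, which are the expansion coefficients of [f] and [g]. *)
- move=> f g Tfg; apply: (expansion_injective _ f g (biorthogonal_expansion f)).
  suff -> : (fun n => (zeta n f)^*) = (fun n => (zeta n g)^*).
    exact: biorthogonal_expansion.
  by apply/funext => n; rewrite -!Te Tfg.
- by rewrite Txi.
Qed.

End Biorthogonal.

(** * Consequences of being a Riesz-like basis *)

(** The adjoint square of [T] is the operator [S], and its values at the [xi n] are the functionals
    [zeta n]. *)
Lemma riesz_like_adjoint_square : riesz_like_basis H ip D j xi ->
  exists2 T : D -> H, inL D (fun u f => ip (T u) (T f)) &
    continuous T /\ orthonormal_basis H ip (fun n => T (xi n)).
Proof.
case=> _ [T [Tin _ eB]]; have [_ Tc] := Tin; exists T => //.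
by apply: inL_ip => //; exact: inC_linear.
Qed.

Lemma riesz_like_positive : riesz_like_basis H ip D j xi ->
  exists S : D -> sdual D, [/\ inL D S, forall f : D, 0 <= S f f &
    forall n k : nat, S (xi n) (xi k) = (n == k)%:R].
Proof.
move=> /riesz_like_adjoint_square[T TL [_ [eO _]]].
by exists (fun u f => ip (T u) (T f)); split=> // f; case: psd.
Qed.

Lemma riesz_like_dual_sequence : riesz_like_basis H ip D j xi ->
  exists zeta : nat -> sdual D,
    (forall n, dualset D (zeta n)) /\ biorthogonal D xi zeta /\
    (forall f : D, cvgn (series (sq_coef D zeta f))) /\
    continuous (p_zeta D zeta : D -> R).
Proof.
move=> /riesz_like_adjoint_square[T [_ Tdual _] [Tc eB]].
have [eO _] := eB.
pose zeta n : sdual D := fun f => ip (T (xi n)) (T f).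
have zT f : series (sq_coef D zeta f) @ \oo --> complex.Re (ip (T f) (T f)).
  have := parseval hip _ (T f) eB.
  suff -> : (fun n => normc (ip (T f) (T (xi n))) ^+ 2) = sq_coef D zeta f by [].
  apply/funext => n; apply: complexI.
  rewrite -sqr_normr_normc /sq_coef -sqr_normr_normc.
  by rewrite (psd_formC psd (T (xi n))) norm_conjC.
exists zeta; split=> [n|]; first exact: Tdual.
split=> [n k|]; first exact: eO.
split=> [f|]; first by apply/cvg_ex; eexists; exact: zT.
have -> : p_zeta D zeta = (fun f => complex.Re `|T f|).
  apply/funext => f; rewrite /p_zeta (cvg_lim (@norm_hausdorff _ R) (zT f)).
  rewrite -(sqr_norm_ip hip).
  have nE : `|T f| = (complex.Re `|T f|)%:C%C by rewrite RRe_real.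
  have n0 : (0 : R) <= complex.Re `|T f| by rewrite -lecR -nE normr_ge0.
  by rewrite {1}nE -rmorphXn /= sqrtr_sqr ger0_norm.
by move=> f; apply: cvg_Re; apply: cvg_norm; exact: Tc.
Qed.

(** * Dual sequences: uniqueness and the converse *)

Lemma biorthogonal_unique (zeta zeta' : nat -> sdual D) :
  (forall n, dualset D (zeta n)) -> biorthogonal D xi zeta ->
  (forall n, dualset D (zeta' n)) -> biorthogonal D xi zeta' -> zeta' = zeta.
Proof.
move=> zd zx zd' zx'; apply/funext => n; apply/funext => f.
have [c [_ cU]] := xi_basis f; apply: (can_inj (@conjCK K)).
have := cU _ (biorthogonal_expansion _ zd zx f).
have := cU _ (biorthogonal_expansion _ zd' zx' f).
by move=> <- /(congr1 (@^~ n)).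
Qed.

Lemma riesz_like_of_dual_sequence (zeta : nat -> sdual D) :
  (forall n, dualset D (zeta n)) -> biorthogonal D xi zeta ->
  (forall f : D, cvgn (series (sq_coef D zeta f))) ->
  continuous (p_zeta D zeta : D -> R) -> riesz_like_basis H ip D j xi.
Proof.
move=> zd zx zc pc.
have zle f N : series (sq_coef D zeta f) N <= limn (series (sq_coef D zeta f)).
  apply: nondecreasing_cvgn_le => //.
  by apply: nondecreasing_series => n _ _; rewrite sqr_ge0.
have p2 f : p_zeta D zeta f ^+ 2 = limn (series (sq_coef D zeta f)).
  by rewrite sqr_sqrtr // (le_trans _ (zle f 0%N)) // /series /= big_geq.
apply: (biorthogonal_riesz_like zeta zd zx (fun f => p_zeta D zeta f ^+ 2)).
  by move=> N f; rewrite p2.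
move=> d d0.
have z0 n : zeta n 0 = 0.
  have [zl _] := zd n; have := zl 1 0 0; rewrite scaler0 addr0 conjC1 mul1r.
  by move/eqP; rewrite -subr_eq0 opprD addNKr oppr_eq0 => /eqP.
have p0 : p_zeta D zeta 0 = 0.
  rewrite /p_zeta (_ : series _ = fun=> 0) ?lim_cst ?sqrtr0 //.
  apply/funext => N; rewrite /series /= big1 // => n _.
  by rewrite /sq_coef z0 ComplexField.Normc.normc0 expr0n.
have sd0 : 0 < Num.sqrt d by rewrite sqrtr_gt0.
have /cvgrPdist_lt/(_ _ sd0) := pc 0.
apply: filterS => f; rewrite p0 sub0r normrN ger0_norm ?sqrtr_ge0 // => pd.
rewrite -[ltRHS]sqr_sqrtr ?ltW // ltr_pXn2r ?nnegrE ?sqrtr_ge0 //.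
Qed.

(** * Positive operators and reflexivity *)

Lemma positive_psd_form (S : D -> sdual D) : inL D S ->
  (forall f, 0 <= S f f) -> psd_form K D S.
Proof. by move=> [Sl Sd _]; split=> // a x y z; have [-> _] := Sd z. Qed.

(* Reflexivity is used only through the continuity of the canonical map into
   the bidual, tested on the strongly bounded set [{S g | S g g <= 1}]. *)
Lemma positive_near0 (S : D -> sdual D) : tvs_reflexive D -> inL D S ->
  (forall f, 0 <= S f f) ->
  forall e : K, 0 < e -> \forall f \near (0 : D), S f f < e.
Proof.
move=> [_ _ _ canon_continuous _] SL S0 e e0; have [_ Sd Sc] := SL.
have Spsd := positive_psd_form S SL S0.
have S00 f : S 0 f = 0 by exact: psd_form0l Spsd f.
pose A := [set S g | g in [set g : D | S g g <= 1]].
have bA : sdual_bounded D A.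
  apply: sdual_boundedP => [_ [g _ <-]//|B bB].
  have [r r0 rB] := bB _ (sdual_continuous0_near S S00 Sc B bB 1 ltr01).
  exists (r + 1) => [|_ f [g /= Sgg <-] Bf]; first exact: addr_gt0.
  have rr : r <= `|r| by rewrite gtr0_norm.
  (* Absorption writes [f] as [r *: u] with [|S u f| < 1]. Cauchy-Schwarz then bounds [|S g f|^2] by
     [r], hence by [(r + 1)^2]. *)
  have Sff : S f f <= r.
    have [u /= uB uf] := rB r rr f Bf.
    rewrite -[leLHS]ger0_norm // -{1}uf (psd_formZl Spsd) normrM gtr0_norm //.
    by rewrite -[leRHS]mulr1 ler_pM2l // ltW // uB.
  have r1 : 0 <= r + 1 by rewrite addr_ge0 // ltW.
  rewrite -(@ler_pXn2r _ 2) ?nnegrE //.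
  rewrite (le_trans (psd_form_cauchy_schwarz Spsd g f)) //.
  apply: (@le_trans _ _ (1 * r)); first exact: ler_pM.
  rewrite mul1r expr2 mulrDl mul1r addrCA lerDl.
  by rewrite addr_ge0 // mulr_ge0 // ltW.
(* Chosen so that [d <= e] and [d < 1]; the latter excludes [S f f >= 1]. *)
pose d := e / (e + 1).
have e10 : 0 < e + 1 by rewrite addr_gt0.
have d0 : 0 < d by rewrite divr_gt0.
have d1 : d < 1 by rewrite ltr_pdivrMr // mul1r ltrDl.
have de : d <= e by rewrite ler_pdivrMr // mulrDr mulr1 lerDr mulr_ge0 // ltW.
have /family_cvgrP/(_ A bA d d0) canon_d := canon_continuous 0.
have : \forall f \near (0 : D), forall Phi, A Phi ->
    `|canon_bidual D 0 Phi - canon_bidual D f Phi| < d by [].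
apply: filterS => f fA.
have {}fA g : S g g <= 1 -> `|S g f| < d.
  move=> Sgg; have := fA (S g); rewrite /canon_bidual (psd_form0r Spsd).
  by rewrite conjC0 sub0r normrN norm_conjC; apply; exists g.
have [Sff|/ltW Sff] := real_leP (ger0_real (S0 f)) (@real1 K).
  by apply: lt_le_trans de; have := fA f Sff; rewrite ger0_norm.
have s0 : 0 < S f f by rewrite (lt_le_trans ltr01).
(* If [S f f >= 1], this [g] satisfies [S g g = (S f f)^-1 <= 1] but [S g f = 1], against
   [d < 1]. *)
have := fA ((S f f)^-1 *: f).
rewrite !(psd_formZl Spsd) (psd_formZr Spsd).
have -> : (S f f)^-1^* = (S f f)^-1 by apply/CrealP; rewrite realV ger0_real.
rewrite mulVf ?gt_eqF // mulr1 invf_le1 // normr1 => /(_ Sff) lt1.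
by have := lt_trans lt1 d1; rewrite ltxx.
Qed.

(** The [xi n] are orthonormal for the form of [S], so Bessel's inequality applies to that form. *)
Lemma riesz_like_of_positive (S : D -> sdual D) : tvs_reflexive D ->
  inL D S -> (forall f, 0 <= S f f) ->
  (forall n k, S (xi n) (xi k) = (n == k)%:R) -> riesz_like_basis H ip D j xi.
Proof.
move=> refl SL S0 Sxi; have [_ Sd _] := SL.
have Spsd := positive_psd_form S SL S0.
have SE f : S f f = (complex.Re (S f f))%:C%C by rewrite RRe_real // ger0_real.
apply: (biorthogonal_riesz_like (S \o xi) _ Sxi (fun f => complex.Re (S f f))).
- by move=> n; exact: Sd.
- move=> N f; rewrite -lecR -SE.
  have -> : (series (sq_coef D (S \o xi) f) N)%:C%C =
      \sum_(0 <= n < N) `|S f (xi n)| ^+ 2.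
    rewrite /series /= rmorph_sum; apply: eq_bigr => n _ /=.
    by rewrite /sq_coef -sqr_normr_normc /= (psd_formC Spsd f) norm_conjC.
  by apply: (bessel Spsd); rewrite ?iota_uniq.
- move=> d d0; have dC : 0 < d%:C%C :> K by rewrite ltcR.
  apply: filterS (positive_near0 S refl SL S0 _ dC) => f.
  by rewrite SE ltcR.
Qed.

End Basis.
End RiggedHilbert.

Theorem theorem3p3 (R : realType) (H : completeNormedModType R[i])
    (ip : H -> H -> R[i]) (D : tvsType R[i]) (j : D -> H) :
  rigged_hilbert H ip D j ->
  tvs_complete D -> tvs_reflexive D -> sdual_quasi_complete D ->
  forall xi : nat -> D, topological_basis D xi ->
  (* (i) <-> (ii) *)
  (riesz_like_basis H ip D j xi <->
   exists zeta : nat -> sdual D,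
     ((forall n, dualset D (zeta n)) /\ biorthogonal D xi zeta /\
      (forall f : D, cvgn (series (sq_coef D zeta f))) /\
      continuous (p_zeta D zeta : D -> R)) /\
     (forall zeta' : nat -> sdual D,
        ((forall n, dualset D (zeta' n)) /\ biorthogonal D xi zeta' /\
         (forall f : D, cvgn (series (sq_coef D zeta' f))) /\
         continuous (p_zeta D zeta' : D -> R)) -> zeta' = zeta)) /\
  (* (i) <-> (iii) *)
  (riesz_like_basis H ip D j xi <->
   exists S : D -> sdual D,
     [/\ inL D S,
         forall f : D, 0 <= S f f &
         forall n k : nat, S (xi n) (xi k) = (n == k)%:R]).
Proof.
move=> rigged _ refl _ xi xi_basis; split; split.
- move=> /(riesz_like_dual_sequence rigged)[zeta zetaP]; exists zeta.
  split=> // zeta' [zd' [zx' _]]; have [zd [zx _]] := zetaP.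
  exact: (biorthogonal_unique xi_basis).
- move=> [zeta [[zd [zx [zc pc]]] _]].
  exact: (riesz_like_of_dual_sequence rigged xi_basis zeta).
- exact: riesz_like_positive.
- move=> [S [SL S0 Sxi]].
  exact: (riesz_like_of_positive rigged xi_basis S).
Qed.
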